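(* Let $k\ge 2$ and let $G$ be an irregular connected $k$-uniform hypergraph with $n$ vertices and $m$ edges, maximum degree $\Delta$, diameter $D$, spectral radius $\rho(G)$ and principal ratio $\gamma$. Then $$\rho(G)<\frac{km\Delta}{km+(n\Delta-km)\gamma^{-k}+\frac{k}{2(k-1)D}\left[1-\gamma^{-\frac k2}\right]^2}.$$
   Context: A $k$-uniform hypergraph $G$ has a finite vertex set $V(G)=\{1,\dots,n\}$ and a set $E(G)$ of edges, each of which is a set of exactly $k$ distinct vertices. The degree $d_i$ of a vertex $i$ is the number of edges containing $i$; $\Delta=\max_i d_i$. $G$ is regular if all vertices have the same degree, and irregular otherwise. A path from $u$ to $v$ is an alternating sequence $v_0e_1v_1e_2\cdots v_{l-1}e_lv_l$ with $v_0=u$, $v_l=v$, where the vertices $v_0,\dots,v_l$ are distinct, the edges $e_1,\dots,e_l$ are distinct, and $v_{i-1},v_i\in e_i$ for $i=1,\dots,l$; its length is $l$. $G$ is connected if there is a path between any two vertices. The distance between two distinct vertices is the length of a shortest path connecting them, and the diameter $D$ is the maximum distance between vertices of $G$. The adjacency tensor of $G$ is $\mathcal{A}_G=(a_{i_1\cdots i_k})$, of order $k$ and dimension $n$, with $a_{i_1\cdots i_k}=\frac{1}{(k-1)!}$ if $\{i_1,\dots,i_k\}\in E(G)$ and $a_{i_1\cdots i_k}=0$ otherwise. For $x\in\mathbb{C}^n$, $\mathcal{A}_Gx^{k-1}\in\mathbb{C}^n$ has $i$-th component $\sum_{i_2,\dots,i_k=1}^n a_{ii_2\cdots i_k}x_{i_2}\cdots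 x_{i_k}$. A number $\lambda\in\mathbb{C}$ is an eigenvalue of $\mathcal{A}_G$ with eigenvector $x\in\mathbb{C}^n\setminus\{0\}$ if $\mathcal{A}_Gx^{k-1}=\lambda x^{[k-1]}$, where $x^{[k-1]}=(x_1^{k-1},\dots,x_n^{k-1})^{\mathrm T}$. The spectral radius $\rho(G)$ is the maximum modulus of the eigenvalues of $\mathcal{A}_G$. For $G$ connected, by the Perron–Frobenius theorem for nonnegative weakly irreducible tensors, $\rho(G)$ is an eigenvalue and there is a unique eigenvector $x=(x_1,\dots,x_n)^{\mathrm T}$ for $\rho(G)$ with all entries positive and $\sum_{i=1}^n x_i^k=1$; it is called the principal eigenvector of $G$. Write $x_{\max}=\max_i x_i$, $x_{\min}=\min_i x_i$. The principal ratio of $G$ is $\gamma=x_{\max}/x_{\min}$. *)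

(* Defs.v *)
From HB Require Import structures.
From mathcomp Require Import all_boot all_order all_algebra.
From mathcomp Require Import complex.
From mathcomp Require Import all_classical all_reals.
From mathcomp Require Import exp.

Set Implicit Arguments.
Unset Strict Implicit.
Unset Printing Implicit Defensive.

Import Order.TTheory GRing.Theory Num.Theory.
Local Open Scope ring_scope.
Local Open Scope complex_scope.

Record hypergraph (k n : nat) := Hypergraph {
  edges : {set {set 'I_n}};
  card_edge : forall e, e \in edges -> #|e| = k }.

Section Combinatorics.
Variables (k n : nat) (G : hypergraph k n).

Definition degree (i : 'I_n) : nat := #|[set e in edges G | i \in e]|.

Definition max_degree : nat := (\max_(i < n) degree i)%N.

Definition regular : Prop := forall i j : 'I_n, degree i = degree j.

(* The sequence s = [:: (e_1, v_1); ...; (e_l, v_l)] encodes the alternating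
   sequence u e_1 v_1 ... e_l v_l, of length l = size s.  The edge component
   set0 paired with the start u is a dummy that [step] never reads. *)
Definition step (a b : {set 'I_n} * 'I_n) : bool :=
  [&& b.1 \in edges G, a.2 \in b.1 & b.2 \in b.1].

Definition is_path (u v : 'I_n) (s : seq ({set 'I_n} * 'I_n)) : bool :=
  [&& path step (finset.set0, u) s, last u (unzip2 s) == v,
      uniq (u :: unzip2 s) & uniq (unzip1 s)].

Definition connected : Prop := forall u v : 'I_n, exists s, is_path u v s.

Definition has_path_of_length (u v : 'I_n) (l : nat) : bool :=
  [exists s : l.-tuple ({set 'I_n} * 'I_n), is_path u v s].

(* The least l admitting a path of length l; since the vertices of a path are
   distinct, every path has length < n.  The value is n if there is no path. *)
Definition distance (u v : 'I_n) : nat :=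
  find (has_path_of_length u v) (iota 0 n).

Definition diameter : nat := (\max_(u < n) \max_(v < n | v != u) distance u v)%N.

End Combinatorics.

(* [A i t] is the entry a_{i i_2 ... i_k} with t = (i_2, ..., i_k). *)
Definition tensor (F : Type) (k n : nat) := 'I_n -> (k.-1).-tuple 'I_n -> F.

(* A x^{k-1} *)
Definition tensor_app (F : fieldType) (k n : nat) (A : tensor F k n)
    (x : 'cV[F]_n) : 'cV[F]_n :=
  \col_i \sum_(t : (k.-1).-tuple 'I_n) A i t * \prod_(j <- t) x j 0.

(* x^{[k-1]} *)
Definition vec_pow (F : fieldType) (k n : nat) (x : 'cV[F]_n) : 'cV[F]_n :=
  \col_i x i 0 ^+ k.-1.

Definition is_eigenpair (F : fieldType) (k n : nat) (A : tensor F k n)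
    (lambda : F) (x : 'cV[F]_n) : Prop :=
  x != 0 /\ tensor_app A x = lambda *: vec_pow k x.

Definition adjacency_tensor (F : fieldType) (k n : nat) (G : hypergraph k n) :
    tensor F k n :=
  fun i t => if [set j in i :: t] \in edges G then ((k.-1)`!%:R)^-1 else 0.

Section Spectral.
Variables (R : realType) (k n : nat) (G : hypergraph k n).

Definition is_eigenvalue (lambda : R[i]) : Prop :=
  exists x : 'cV[R[i]]_n, is_eigenpair (adjacency_tensor R[i] G) lambda x.

(* The moduli are bounded by the maximum degree, so this supremum is the maximum
   modulus as soon as it is attained, in particular whenever G has a principal
   eigenvector as defined below. *)
Definition spectral_radius : R :=
  sup [set r : R | exists2 lambda : R[i], is_eigenvalue lambda
                                        & r = complex.Re `|lambda|]%classic.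

Definition is_principal_eigenvector (x : 'cV[R]_n) : Prop :=
  [/\ is_eigenpair (adjacency_tensor R[i] G) (spectral_radius%:C)
        (map_mx (real_complex R) x),
      forall i, 0 < x i 0
    & \sum_(i < n) x i 0 ^+ k = 1].

End Spectral.

Section PrincipalRatio.
Variables (R : realType) (n : nat) (x : 'cV[R]_n).

(* For a vector with positive entries and n > 0, the initial values 0 and
   [vec_max] do not affect the maximum and the minimum. *)
Definition vec_max : R := \big[Num.max/0]_(i < n) x i 0.
Definition vec_min : R := \big[Num.min/vec_max]_(i < n) x i 0.

Definition principal_ratio : R := vec_max / vec_min.

End PrincipalRatio.

(* Main.v *)
Require Import Defs.
From mathcomp Require Import all_boot all_order all_algebra.
From mathcomp Require Import complex.
From mathcomp Require Import all_classical all_reals.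
From mathcomp Require Import exp.
From mathcomp Require Import ring lra zify.

Set Implicit Arguments.
Unset Strict Implicit.
Unset Printing Implicit Defensive.

Import Order.TTheory GRing.Theory Num.Theory.
Local Open Scope ring_scope.

(** Write [x] for the principal eigenvector, [u] and [v] for vertices where it
    is largest and smallest, [m] for the number of edges and [x^e] for the
    product of the entries of [x] over an edge [e].

    Pairing the eigenvalue equation with [x] gives [rho = k * sum_e x^e], since
    every edge is counted once for each of its [k] vertices.  As the [k]-th
    powers of the entries sum to [1], this turns [Delta - rho] into a sum of
    nonnegative terms ([degree_gapE]): the degree deficits
    [(Delta - d_i) x_i^k], and for every edge the AM-GM defect
    [sum_(i in e) x_i^k - k x^e].

    The deficits add up to at least [(n Delta - k m) x_v^k].  The defect of an
    edge is bounded below by the spread of [y_i = x_i^(k/2)] on it: AM-GM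
    applied to all products [y_i y_j] of pairs in [e], rather than to the
    [x_i^k] themselves, leaves [k - 1] times the defect at least
    [k sum y_i^2 - (sum y_i)^2] ([AGM_pairs]), a variance, and this is at least
    [k/2 (y_a - y_b)^2] for any two vertices [a], [b] of [e]
    ([sum_sq_spread]).  Adding this along a shortest path from [u] to [v], with
    Cauchy-Schwarz on its at most [D] steps, bounds the sum of the defects from
    below by a multiple of [(y_u - y_v)^2] ([spread_le_edge_defects]).  Altogether
    [Delta - rho >= x_u^k B], where [B] is the sum of the last two terms of the
    denominator in the theorem.

    Finally [rho < k m x_u^k] ([radius_lt_edges]): otherwise [x] would be
    constant, and the eigenvalue equations would force all degrees to be
    [rho].  As irregularity gives [B > 0], it follows that
    [rho B < k m x_u^k B <= k m (Delta - rho)], which is the claim. *)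

(** * The adjacency tensor as a sum over edges *)

Lemma completes_edgeE (n k : nat) (e : {set 'I_n}) (i : 'I_n)
    (t : k.-1.-tuple 'I_n) :
  (0 < k)%N -> #|e| = k -> i \in e ->
  ([set j in i :: t] == e) = all (mem (e :\ i)) t && uniq t.
Proof.
move=> k0 ek ie.
have st : size (i :: t) = k by rewrite /= size_tuple prednK.
apply/eqP/andP => [E | [/allP sub ut]].
  have ut : uniq (i :: t).
    by apply/card_uniqP; rewrite st -[RHS]ek -E cardsE.
  move: ut => /= /andP[it ut]; split=> //; apply/allP => j jt /=.
  rewrite !inE -E !inE jt orbT andbT.
  by apply: contraNneq it => <-.
have uit : uniq (i :: t).
  rewrite /= ut andbT; apply/negP => /sub /=; by rewrite !inE eqxx.
apply/eqP; rewrite eqEcard cardsE (card_uniqP uit) st ek leqnn andbT.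
apply/fintype.subsetP => j; rewrite !inE => /orP[/eqP-> // | /sub /=].
by rewrite !inE => /andP[].
Qed.

(** The [(k-1)!] orderings of the vertices of an edge other than [i] give equal
    terms, which cancels the normalization of the tensor. *)
Lemma adjacency_tensor_app (F : numFieldType) (k n : nat) (G : hypergraph k n)
    (x : 'cV[F]_n) (i : 'I_n) : (0 < k)%N ->
  tensor_app (adjacency_tensor F G) x i 0 =
  \sum_(e in edges G | i \in e) \prod_(j in e :\ i) x j 0.
Proof.
move=> k0; rewrite mxE.
rewrite (bigID (fun t : k.-1.-tuple 'I_n => [set j in i :: t] \in edges G)) /=.
rewrite [X in _ + X]big1 ?addr0; last first.
  by move=> t /negPf nt; rewrite /adjacency_tensor nt mul0r.
rewrite (partition_big (fun t : k.-1.-tuple 'I_n => [set j in i :: t])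
  (fun e => (e \in edges G) && (i \in e))) /=; last first.
  by move=> t ->; rewrite !inE eqxx.
apply: eq_bigr => e /andP[eG ie].
have ek := card_edge eG.
pose S := [set t : k.-1.-tuple 'I_n | all (mem (e :\ i)) t & uniq t].
have SP t : (t \in S) = ([set j in i :: t] == e).
  by rewrite inE; apply/esym/completes_edgeE.
rewrite (eq_bigl (fun t => t \in S)); last first.
  by move=> t; rewrite SP; case: eqP => [->|]; rewrite ?eG ?andbF.
rewrite (eq_bigr (fun=> (k.-1)`!%:R^-1 * \prod_(j in e :\ i) x j 0)); last first.
  move=> t tS; have /eqP tE : [set j in i :: t] == e by rewrite -SP.
  rewrite /adjacency_tensor tE eG; congr (_ * _).
  move: tS; rewrite inE => /andP[/allP sub ut]; rewrite big_uniq //=.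
  apply: eq_bigl => j; apply/idP/idP; first exact: sub.
  by rewrite in_setD1 -tE !inE => /andP[/negPf->].
rewrite sumr_const card_uniq_tuples.
have -> : #|mem (e :\ i)| = k.-1 by rewrite -ek (cardsD1 i e) ie.
rewrite ffactnn -[LHS]mulr_natr mulrAC mulVf ?mul1r //.
by rewrite pnatr_eq0 -lt0n fact_gt0.
Qed.

(** * The AM-GM defect of an edge *)

(** AM-GM for the [k (k - 1)] numbers [(z i * z j) ^+ k] over ordered pairs of
    distinct elements: each [z i] occurs in [2 (k - 1)] of them, so their
    geometric mean is the product of the [z i ^+ 2], and their sum is the
    right-hand side. *)
Lemma AGM_pairs (R : realFieldType) (T : finType) (A : {set T}) (z : T -> R) :
  (2 <= #|A|)%N ->
  (forall i, i \in A -> 0 <= z i) ->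
  #|A|%:R * (#|A|%:R - 1) * \prod_(i in A) z i ^+ 2 <=
  (\sum_(i in A) z i ^+ #|A|) ^+ 2 - \sum_(i in A) (z i ^+ #|A|) ^+ 2.
Proof.
set k := #|A| => k2 z0.
pose P := [pred p : T * T | (p.1 \in A) && (p.2 \in A :\ p.1)].
pose E (p : T * T) := (z p.1 * z p.2) ^+ k.
have k1 : (k%:R - 1 : R) = k.-1%:R by rewrite -subn1 natrB // ltnW.
have cP : #|P| = (k * k.-1)%N.
  rewrite -sum1_card -(pair_big_dep (mem A) (fun i j => j \in A :\ i) (fun _ _ => 1%N)) /=.
  rewrite (eq_bigr (fun=> k.-1)) ?sum_nat_const // => i iA.
  by rewrite sum1_card /k (cardsD1 i A) iA.
have sumE : \sum_(p in P) E p =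
    (\sum_(i in A) z i ^+ k) ^+ 2 - \sum_(i in A) (z i ^+ k) ^+ 2.
  rewrite -(pair_big_dep (mem A) (fun i j => j \in A :\ i) (fun i j => E (i, j))) /=.
  rewrite [in RHS]expr2 mulr_suml -sumrB; apply: eq_bigr => i iA.
  rewrite (big_setD1 i iA) /= mulrDr expr2 addrC addKr mulr_sumr.
  by apply: eq_bigr => j _; rewrite /E exprMn.
have prodE : \prod_(p in P) E p = (\prod_(i in A) z i ^+ 2) ^+ (k * k.-1).
  rewrite -(pair_big_dep (mem A) (fun i j => j \in A :\ i) (fun i j => E (i, j))) /=.
  rewrite /E /=.
  under eq_bigr => i iA do rewrite prodrXl big_split /= prodr_const.
  rewrite prodrXl big_split /=.
  have -> : \prod_(i in A) z i ^+ #|A :\ i| = (\prod_(i in A) z i) ^+ k.-1.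
    rewrite -prodrXl; apply: eq_bigr => i iA.
    by rewrite /k (cardsD1 i A) iA.
  have -> : \prod_(i in A) \prod_(j in A :\ i) z j = (\prod_(i in A) z i) ^+ k.-1.
    rewrite (exchange_big_dep (mem A)) /=; last by move=> i j _; rewrite inE => /andP[].
    rewrite -prodrXl; apply: eq_bigr => j jA.
    rewrite prodr_const /k (cardsD1 j A) jA /=; congr (_ ^+ _).
    by apply: eq_card => i; rewrite -topredE /= !inE jA andbT eq_sym andbC.
  by rewrite prodrXl -exprD -!exprM; congr (_ ^+ _); lia.
have E0 : {in P, forall p, 0 <= E p}.
  move=> [i j] /andP[/= iA]; rewrite inE => /andP[_ jA].
  by rewrite exprn_ge0 // mulr_ge0 ?z0.
have N0 : (0 < k * k.-1)%N by move: k2; case: (k) => [|[]].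
have [+ _] := leif_AGM E0; rewrite -sumE prodE cP.
rewrite ler_pXn2r ?nnegrE //; first last.
- by rewrite divr_ge0 ?sumr_ge0.
- by apply: prodr_ge0 => i iA; rewrite exprn_ge0 ?z0.
by rewrite k1 -natrM ler_pdivlMr ?ltr0n // mulrC.
Qed.

(** The right-hand side is [#|A|] times the sum of squared deviations from the
    mean.  The deviations at [a] and [b] alone give the bound; this is sharp
    when all other values are equal to the mean and [y a], [y b] are symmetric
    about it. *)
Lemma sum_sq_spread (R : realFieldType) (T : finType) (A : {set T}) (y : T -> R) a b :
  a \in A -> b \in A ->
  #|A|%:R / 2 * (y a - y b) ^+ 2 <=
  #|A|%:R * \sum_(i in A) y i ^+ 2 - (\sum_(i in A) y i) ^+ 2.
Proof.
move=> aA bA; set k : R := #|A|%:R; set S := \sum_(i in A) y i.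
have k0 : 0 < k by rewrite ltr0n; apply/card_gt0P; exists a.
pose mu := S / k.
have varE : k * \sum_(i in A) y i ^+ 2 - S ^+ 2 = k * \sum_(i in A) (y i - mu) ^+ 2.
  have -> : \sum_(i in A) (y i - mu) ^+ 2 =
      \sum_(i in A) y i ^+ 2 - 2 * mu * S + k * mu ^+ 2.
    rewrite /S mulr_sumr -sumrB /k [#|A|%:R * _]mulr_natl -sumr_const -big_split /=.
    by apply: eq_bigr => i _; ring.
  by rewrite /mu; field; rewrite gt_eqF.
rewrite varE -mulrA ler_pM2l //.
have [->|ab] := eqVneq a b.
  by rewrite subrr expr0n mulr0 sumr_ge0 // => i _; rewrite sqr_ge0.
rewrite (big_setD1 a aA) (big_setD1 b) /=; last by rewrite !inE eq_sym ab.
rewrite addrA.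
apply: (@le_trans _ _ ((y a - mu) ^+ 2 + (y b - mu) ^+ 2)); last first.
  by rewrite lerDl sumr_ge0 // => i _; rewrite sqr_ge0.
by have := sqr_ge0 ((y a - mu) + (y b - mu)); nra.
Qed.

(** Combines the two previous bounds for [z := sqrt x].  Writing [x i ^ (k/2)]
    as a natural power of a square root keeps the argument free of real
    exponents. *)
Lemma edge_AGM_defect (R : rcfType) (T : finType) (A : {set T}) (x : T -> R) a b :
  (2 <= #|A|)%N -> (forall i, i \in A -> 0 <= x i) -> a \in A -> b \in A ->
  #|A|%:R / (2 * (#|A|%:R - 1)) *
    (Num.sqrt (x a) ^+ #|A| - Num.sqrt (x b) ^+ #|A|) ^+ 2 <=
  \sum_(i in A) x i ^+ #|A| - #|A|%:R * \prod_(i in A) x i.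
Proof.
move=> k2 x0 aA bA; set k := #|A| in k2 *.
pose z i := Num.sqrt (x i).
have k1 : 0 < k%:R - 1 :> R by rewrite subr_gt0 ltr1n.
have := @AGM_pairs R T A z k2 (fun i _ => sqrtr_ge0 _).
have := sum_sq_spread (fun i => z i ^+ k) aA bA.
rewrite -/k -/(z a) -/(z b).
have -> : \prod_(i in A) z i ^+ 2 = \prod_(i in A) x i.
  by apply: eq_bigr => i iA; rewrite sqr_sqrtr ?x0.
have -> : \sum_(i in A) (z i ^+ k) ^+ 2 = \sum_(i in A) x i ^+ k.
  by apply: eq_bigr => i iA; rewrite exprAC sqr_sqrtr ?x0.
set p := \prod_(i in A) _; set S := \sum_(i in A) x i ^+ k.
set Q := (\sum_(i in A) _) ^+ 2; set d := (_ - _) ^+ 2 => h1 h2.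
have -> : k%:R / (2 * (k%:R - 1)) * d = (k%:R / 2 * d) / (k%:R - 1) :> R.
  by field; rewrite gt_eqF.
rewrite ler_pdivrMr //; lra.
Qed.

(** * Summing along a shortest path *)

(** Cauchy-Schwarz for the telescoping sum of the increments of [y] along the
    path, with each squared increment bounded by a weight on its edge. *)
Lemma path_spread (R : realFieldType) (k n : nat) (G : hypergraph k n) (y : 'I_n -> R)
   (g : {set 'I_n} -> R) (a : {set 'I_n} * 'I_n) s :
  (forall e i j, e \in edges G -> i \in e -> j \in e -> (y i - y j) ^+ 2 <= g e) ->
  path (step G) a s ->
  (y a.2 - y (last a.2 (unzip2 s))) ^+ 2 <=
    (size s)%:R * \sum_(e <- unzip1 s) g e.
Proof.
move=> hg; elim: s a => [|[e v] s IH] [f u] /=.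
  by rewrite subrr expr0n mul0r.
case/andP => /and3P[/= eG ue ve] /IH /=.
have := hg e u v eG ue ve; rewrite big_cons.
set S := \sum_(_ <- _) _; set w := last _ _.
have -> : y u - y w = (y u - y v) + (y v - y w) by ring.
set p := y u - y v; set q := y v - y w; set l : R := (size s)%:R => hp hq.
have l0 : 0 <= l by [].
have g0 := le_trans (sqr_ge0 p) hp.
rewrite -[(size s).+1]addn1 natrD -/l.
(* An empty tail must be treated apart: the bound [hq] then says nothing
   about the sign of [S]. *)
have [lE|ln] := eqVneq l 0.
  have q0 : q = 0.
    apply/eqP; rewrite -[_ == _]sqrf_eq0 eq_le sqr_ge0 andbT.
    by rewrite lE mul0r in hq.
  have S0 : 0 <= S.
    have := size_eq0 s; move/eqP: lE; rewrite pnatr_eq0 => ->.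
    by move/esym/eqP; rewrite /S => ->; rewrite big_nil.
  by rewrite lE q0 !addr0 add0r mul1r; lra.
have lp : 0 < l by rewrite lt_neqAle eq_sym ln.
have S0 : 0 <= S by rewrite -(pmulr_rge0 _ lp); exact: le_trans (sqr_ge0 q) hq.
have : 2 * p * q <= l * g e + S.
  apply: le_trans (ler_norm _) _.
  rewrite -(@ler_pXn2r _ 2%N) // ?nnegrE ?addr_ge0 ?mulr_ge0 //.
  rewrite real_normK ?num_real //.
  have := ler_pM (sqr_ge0 p) (sqr_ge0 q) hp hq.
  have := sqr_ge0 (l * g e - S); nra.
lra.
Qed.

(** The search defining the distance only tries lengths below [n]; it succeeds
    because the distinct vertices of a path leave it no room to be longer. *)
Lemma distance_attained (k n : nat) (G : hypergraph k n) (u v : 'I_n) :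
  connected G -> exists2 s, is_path G u v s & size s = distance G u v.
Proof.
move=> /(_ u v) [s sP].
have szn : (size s < n)%N.
  case/and4P: sP => _ _ us _.
  by have := max_card (mem (u :: unzip2 s)); rewrite (card_uniqP us) card_ord /= size_map.
have hs : has (has_path_of_length G u v) (iota 0 n).
  apply/hasP; exists (size s); first by rewrite mem_iota.
  by apply/existsP; exists (in_tuple s).
have := nth_find 0%N hs.
move: (hs); rewrite has_find size_iota => lt; rewrite nth_iota // add0n.
by case/existsP => t tP; exists t; rewrite ?size_tuple.
Qed.

Lemma distance_le_diameter (k n : nat) (G : hypergraph k n) (u v : 'I_n) :
  v != u -> (distance G u v <= diameter G)%N.
Proof.
move=> vu; rewrite /diameter (bigD1 u) //= leq_max; apply/orP; left.
exact: leq_bigmax_cond.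
Qed.

(** * Double counting and the eigenvalue equations *)

Lemma sum_degree_mul (R : pzRingType) (k n : nat) (G : hypergraph k n) (f : 'I_n -> R) :
  \sum_i (degree G i)%:R * f i = \sum_(e in edges G) \sum_(i in e) f i.
Proof.
rewrite (exchange_big_dep xpredT) //=; apply: eq_bigr => i _.
rewrite sumr_const mulr_natl; congr (_ *+ _).
by apply: eq_card => e; rewrite inE.
Qed.

Lemma sum_degree (R : pzRingType) (k n : nat) (G : hypergraph k n) :
  \sum_i (degree G i)%:R = k%:R * #|edges G|%:R :> R.
Proof.
under eq_bigr => i _ do rewrite -[(degree G i)%:R]mulr1.
rewrite sum_degree_mul (eq_bigr (fun=> k%:R)); first by rewrite sumr_const mulr_natr.
by move=> e eG; rewrite sumr_const (card_edge eG).
Qed.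

Definition edge_product (R : pzRingType) (n : nat) (x : 'I_n -> R) (e : {set 'I_n}) : R :=
  \prod_(i in e) x i.

Definition eigen_equations (R : pzRingType) (k n : nat) (G : hypergraph k n)
    (rho : R) (x : 'I_n -> R) : Prop :=
  forall i, \sum_(e in edges G | i \in e) edge_product x (e :\ i) = rho * x i ^+ k.-1.

(** The eigenpair is given over the complex numbers, but tensor, eigenvalue and
    vector are real, so the equations descend along the embedding. *)
Lemma principal_eigen_equations (R : realType) (k n : nat) (G : hypergraph k n)
    (x : 'cV[R]_n) : (0 < k)%N ->
  is_principal_eigenvector G x ->
  eigen_equations G (spectral_radius R G) (fun i => x i 0).
Proof.
move=> k0 [[_ xE] _ _] i.
have := congr1 (fun y : 'cV[R[i]]_n => y i 0) xE.
rewrite adjacency_tensor_app // !mxE => E.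
apply: (fmorph_inj (real_complex R)).
rewrite rmorphM rmorphXn /= -E rmorph_sum; apply: eq_bigr => e _.
by rewrite rmorph_prod; apply: eq_bigr => j _; rewrite mxE.
Qed.

(** Multiply the [i]-th equation by [x i] and sum over [i]: each edge product
    then appears once for every vertex of the edge. *)
Lemma eigen_equations_edge_sum (R : comPzRingType) (k n : nat) (G : hypergraph k n)
    (rho : R) (x : 'I_n -> R) : (0 < k)%N ->
  eigen_equations G rho x -> \sum_i x i ^+ k = 1 ->
  rho = k%:R * \sum_(e in edges G) edge_product x e.
Proof.
move=> k0 xE x1; rewrite -[LHS]mulr1 -[X in _ * X = _]x1 mulr_sumr.
under eq_bigr => i _ do rewrite -[X in _ ^+ X](prednK k0) exprSr mulrA -xE mulr_suml.
rewrite (exchange_big_dep (mem (edges G))) /=; last by move=> i e _ /andP[].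
rewrite mulr_sumr; apply: eq_bigr => e eG.
under eq_bigl => i do rewrite eG /=.
rewrite (eq_bigr (fun=> edge_product x e)) => [|i ie].
  by rewrite sumr_const (card_edge eG) mulr_natl.
by rewrite /edge_product (big_setD1 i ie) /= mulrC.
Qed.

(** The weights [degree G i * x i ^+ k] of the first sum are the vertex terms of
    the second one by double counting, so both cancel. *)
Lemma degree_gapE (R : comPzRingType) (k n : nat) (G : hypergraph k n)
    (rho Delta : R) (x : 'I_n -> R) : (0 < k)%N ->
  eigen_equations G rho x -> \sum_i x i ^+ k = 1 ->
  Delta - rho = \sum_i (Delta - (degree G i)%:R) * x i ^+ k +
    \sum_(e in edges G) (\sum_(i in e) x i ^+ k - k%:R * edge_product x e).
Proof.
move=> k0 xE x1; rewrite {1}(eigen_equations_edge_sum k0 xE x1).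
under [X in _ = X + _]eq_bigr => i _ do rewrite mulrBl.
rewrite !sumrB -!mulr_sumr x1 mulr1 sum_degree_mul.
by rewrite addrA subrK.
Qed.

(** The edges of a path are distinct, so their defects are part of the sum of
    all the nonnegative defects, and a shortest path has at most
    [diameter G] of them. *)
Lemma spread_le_edge_defects (R : rcfType) (k n : nat) (G : hypergraph k n)
    (x : 'I_n -> R) (u v : 'I_n) :
  (2 <= k)%N -> connected G -> (forall i, 0 <= x i) ->
  k%:R / (2 * (k%:R - 1) * (diameter G)%:R) *
    (Num.sqrt (x u) ^+ k - Num.sqrt (x v) ^+ k) ^+ 2 <=
  \sum_(e in edges G) (\sum_(i in e) x i ^+ k - k%:R * edge_product x e).
Proof.
move=> k2 hconn x0.
pose d (e : {set 'I_n}) := \sum_(i in e) x i ^+ k - k%:R * edge_product x e.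
rewrite -[leRHS]/(\sum_(e in edges G) d e); set S := \sum_(e in _) _.
pose y i := Num.sqrt (x i) ^+ k.
pose c : R := k%:R / (2 * (k%:R - 1)).
have k1 : 0 < k%:R - 1 :> R by rewrite subr_gt0 ltr1n.
have kp : 0 < k%:R :> R by rewrite ltr0n ltnW.
have c0 : 0 < c by rewrite divr_gt0 ?mulr_gt0.
have hd e i j : e \in edges G -> i \in e -> j \in e -> c * (y i - y j) ^+ 2 <= d e.
  move=> eG ie je; have ek := card_edge eG.
  have := @edge_AGM_defect R _ e x i j.
  by rewrite ek; apply.
have d0 e : e \in edges G -> 0 <= d e.
  (* The case [a = b] of the bound is the AM-GM inequality itself. *)
  move=> eG; have /card_gt0P[i ie] : (0 < #|e|)%N by rewrite (card_edge eG) ltnW.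
  by have := hd e i i eG ie ie; rewrite subrr expr0n mulr0.
have S0 : 0 <= S by exact: sumr_ge0.
have [->|uv] := eqVneq u v; first by rewrite subrr expr0n mulr0.
have [s /and4P[sp /eqP sv _ us] sd] := distance_attained u v hconn.
have lD : (size s <= diameter G)%N by rewrite sd distance_le_diameter // eq_sym.
have s0 : (0 < size s)%N.
  by case: (s) sv => //= uv'; rewrite uv' eqxx in uv.
have D0 : 0 < (diameter G)%:R :> R by rewrite ltr0n (leq_trans s0).
have h : (y u - y v) ^+ 2 <= (size s)%:R * \sum_(e <- unzip1 s) (d e / c).
  rewrite -{1}sv; apply: (path_spread _ sp) => e i j eG ie je.
  by rewrite ler_pdivlMr // mulrC hd.
have -> : k%:R / (2 * (k%:R - 1) * (diameter G)%:R) = c / (diameter G)%:R :> R.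
  by rewrite /c; field; rewrite !gt_eqF.
rewrite -/(y u) -/(y v) mulrAC ler_pdivrMr // -ler_pdivlMl //.
apply: le_trans h _.
rewrite -mulr_suml mulrA mulrC ler_pM2l ?invr_gt0 //.
have sE e : e \in unzip1 s -> e \in edges G.
  elim: (s) (finset.set0, u) sp => //= [[f w] t IH] a /andP[/and3P[/= fG _ _] tp].
  by rewrite inE => /orP[/eqP->//|]; exact: IH tp.
rewrite [leRHS]mulrC; apply: ler_pM => //.
- by rewrite big_seq sumr_ge0 // => e /sE/d0.
- by rewrite ler_nat.
rewrite big_uniq //= [S](bigID (mem (unzip1 s))) /=.
rewrite [X in _ <= X + _](eq_bigl (mem (unzip1 s))); last first.
  by move=> e /=; case: (boolP (e \in unzip1 s)) => [/sE->|]; rewrite ?andbF.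
by rewrite lerDl sumr_ge0 // => e /andP[/d0].
Qed.

(** * Strictness from irregularity *)

Lemma degree_le_max (k n : nat) (G : hypergraph k n) (i : 'I_n) :
  (degree G i <= max_degree G)%N.
Proof. exact: leq_bigmax. Qed.

Lemma irregular_degree_lt (k n : nat) (G : hypergraph k n) :
  ~ regular G -> exists i, (degree G i < max_degree G)%N.
Proof.
move=> irr; apply/existsP; apply: contraT => /existsPn all_max; case: irr.
suff dmax i : degree G i = max_degree G by move=> i j; rewrite !dmax.
by apply/eqP; rewrite eqn_leq degree_le_max leqNgt all_max.
Qed.

Lemma edges_gt0 (k n : nat) (G : hypergraph k n) :
  ~ regular G -> (0 < #|edges G|)%N.
Proof.
move=> irr; rewrite lt0n cards_eq0; apply/eqP => E0; apply: irr.
suff d0 i : degree G i = 0%N by move=> i j; rewrite !d0.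
by apply: eq_card0 => e; rewrite inE E0 inE.
Qed.

Lemma edge_product_le (R : realDomainType) (n : nat) (x : 'I_n -> R) (M : R)
    (e : {set 'I_n}) :
  (forall i, 0 <= x i <= M) -> edge_product x e <= M ^+ #|e|.
Proof.
by move=> xM; rewrite -prodr_const; apply: ler_prod => i _; exact: xM.
Qed.

(** If an edge product reaches its upper bound, none of its factors can be
    smaller than [M]. *)
Lemma edge_product_max (R : realDomainType) (n : nat) (x : 'I_n -> R) (M : R)
    (e : {set 'I_n}) (i : 'I_n) :
  (forall i, 0 < x i <= M) -> i \in e ->
  M ^+ #|e| <= edge_product x e -> x i = M.
Proof.
move=> xM ie; have /andP[xi xiM] := xM i; have M0 := lt_le_trans xi xiM.
have xM' j : 0 <= x j <= M by have /andP[/ltW-> ->] := xM j.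
rewrite /edge_product (big_setD1 i ie) /= (cardsD1 i e) ie exprS => h.
apply/eqP; rewrite eq_le xiM /=.
rewrite -(@ler_pM2r _ (M ^+ #|e :\ i|)) ?exprn_gt0 //.
apply: le_trans h _; rewrite ler_pM2l //; exact: edge_product_le.
Qed.

(** If [k m M^k <= rho], then every edge product reaches its bound [M ^+ k], so
    [x] is [M] on every vertex that lies in an edge.  Every vertex does:
    otherwise its equation would read [0 = rho * x i ^+ k.-1].  With [x]
    constant, the equations say that every degree is [rho]. *)
Lemma radius_lt_edges (R : realFieldType) (k n : nat) (G : hypergraph k n)
    (rho : R) (x : 'I_n -> R) (M : R) :
  (0 < k)%N -> ~ regular G -> (forall i, 0 < x i <= M) ->
  eigen_equations G rho x -> \sum_i x i ^+ k = 1 ->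
  rho < k%:R * #|edges G|%:R * M ^+ k.
Proof.
move=> k0 irr xM xE x1.
have xM' j : 0 <= x j <= M by have /andP[/ltW-> ->] := xM j.
have kp : 0 < k%:R :> R by rewrite ltr0n.
have rhoE := eigen_equations_edge_sum k0 xE x1.
have le e : e \in edges G -> edge_product x e <= M ^+ k.
  by move=> /card_edge <-; exact: edge_product_le.
have m0 := edges_gt0 irr.
rewrite ltNge; apply/negP => ge; apply: irr.
have prodE e : e \in edges G -> edge_product x e = M ^+ k.
  move=> eG; apply/eqP; rewrite -subr_eq0 -oppr_eq0 opprB.
  have : \sum_(e in edges G) (M ^+ k - edge_product x e) == 0.
    rewrite eq_le sumr_ge0 ?andbT; last by move=> f fG; rewrite subr_ge0 le.
    rewrite sumrB sumr_const -mulr_natl subr_le0 -(ler_pM2l kp) -rhoE mulrA.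
    exact: ge.
  rewrite psumr_eq0 => [/allP /(_ e)|f fG]; last by rewrite subr_ge0 le.
  by rewrite mem_index_enum eG => /(_ isT).
(* The vertex [i] only serves to show that [M] is positive. *)
have rho0 (i : 'I_n) : 0 < rho.
  have /andP[p q] := xM i; apply: lt_le_trans ge.
  by rewrite !mulr_gt0 ?exprn_gt0 ?(lt_le_trans p q) // ltr0n.
have xmax i : x i = M.
  have : rho * x i ^+ k.-1 != 0.
    by rewrite mulf_neq0 ?expf_neq0 // gt_eqF //; [exact: rho0 | have /andP[] := xM i].
  have [/existsP[e /andP[eG ie]] _|none] := boolP [exists e in edges G, i \in e].
    apply: (edge_product_max xM ie).
    by rewrite prodE // (card_edge eG).
  rewrite -xE big1 ?eqxx // => e /andP[eG ie].
  by case/negP: none; apply/existsP; exists e; rewrite eG.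
suff dE i : (degree G i)%:R = rho.
  by move=> i j; apply/eqP; rewrite -(eqr_nat R) !dE.
have M0 : M != 0 by have /andP[p q] := xM i; rewrite gt_eqF // (lt_le_trans p).
apply: (mulIf (expf_neq0 k.-1 M0)); rewrite -[in RHS](xmax i) -xE.
rewrite (eq_bigr (fun=> M ^+ k.-1)) => [|e /andP[eG ie]].
  rewrite sumr_const mulr_natl; congr (_ *+ _).
  by apply: eq_card => e; rewrite inE.
rewrite /edge_product (eq_bigr (fun=> M)) // prodr_const; congr (_ ^+ _).
by rewrite -(card_edge eG) (cardsD1 i e) ie.
Qed.

(** * The extreme entries and the final estimate *)

Lemma vec_max_attained (R : realType) (n : nat) (x : 'cV[R]_n) (i0 : 'I_n) :
  (forall i, 0 < x i 0) ->
  exists2 u, vec_max x = x u 0 & forall i, x i 0 <= x u 0.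
Proof.
move=> x0; have [u _ umax] := arg_maxP (fun i => x i 0) (erefl : xpredT i0).
exists u => [|i]; last exact: umax.
apply/eqP; rewrite eq_le (le_bigmax _ (fun i => x i 0)) andbT.
by apply: bigmax_le => [|i _]; [exact: ltW | exact: umax].
Qed.

Lemma vec_min_attained (R : realType) (n : nat) (x : 'cV[R]_n) (i0 : 'I_n) :
  exists2 v, vec_min x = x v 0 & forall i, x v 0 <= x i 0.
Proof.
have [v _ vmin] := arg_minP (fun i => x i 0) (erefl : xpredT i0).
exists v => [|i]; last exact: vmin.
apply/eqP; rewrite eq_le (bigmin_le _ _ (fun i => x i 0)) /=.
apply: le_bigmin => [|i _]; last exact: vmin.
exact: (le_bigmax _ (fun i => x i 0)).
Qed.

Lemma powR_half (R : realType) (g : R) (k : nat) :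
  0 <= g -> g `^ (k%:R / 2) = Num.sqrt g ^+ k.
Proof.
by move=> g0; rewrite mulrC powRrM powR12_sqrt // powR_mulrn ?sqrtr_ge0.
Qed.

Theorem theorem3p4 (R : realType) (k n m Delta D : nat) (G : hypergraph k n)
    (x : 'cV[R]_n) (rho gamma : R)
    (hk : (2 <= k)%N)
    (hconn : connected G)
    (hirr : ~ regular G)
    (hm : m = #|edges G|)
    (hDelta : Delta = max_degree G)
    (hD : D = diameter G)
    (hrho : rho = spectral_radius R G)
    (hx : is_principal_eigenvector G x)
    (hgamma : gamma = principal_ratio x) :
  rho < (k%:R * m%:R * Delta%:R) /
        (k%:R * m%:R + (n%:R * Delta%:R - k%:R * m%:R) * gamma ^- k
         + k%:R / (2 * (k%:R - 1) * D%:R)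
           * (1 - gamma `^ (- (k%:R / 2))) ^+ 2).
Proof.
have k0 : (0 < k)%N := ltnW hk.
have xE := principal_eigen_equations k0 hx; rewrite -hrho in xE.
have [_ xpos x1] := hx.
have [w dw] := irregular_degree_lt hirr.
have [u Mu umax] := vec_max_attained w xpos.
have [v mv vmin] := vec_min_attained x w.
have up := xpos u; have vp := xpos v.
set K : R := k%:R * m%:R; set c := k%:R / _.
have kp : 0 < k%:R :> R by rewrite ltr0n.
have K0 : 0 < K by rewrite mulr_gt0 // ltr0n hm edges_gt0.
have c0 : 0 <= c.
  by rewrite divr_ge0 ?mulr_ge0 // subr_ge0 ler1n.
have KE : n%:R * Delta%:R - K = \sum_i (Delta%:R - (degree G i)%:R) :> R.
  by rewrite sumrB sum_degree -hm -/K sumr_const card_ord mulr_natl.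
have dle i : 0 <= Delta%:R - (degree G i)%:R :> R.
  by rewrite subr_ge0 ler_nat hDelta degree_le_max.
have nD0 : 0 < n%:R * Delta%:R - K.
  rewrite KE (bigD1 w) //= ltr_pwDl ?sumr_ge0 //.
  by rewrite subr_gt0 ltr_nat hDelta.
have gE : gamma = x u 0 / x v 0 by rewrite hgamma /principal_ratio Mu mv.
have gp : 0 < gamma by rewrite gE divr_gt0.
set B := (n%:R * Delta%:R - K) * gamma ^- k + c * (1 - gamma `^ (- (k%:R / 2))) ^+ 2.
have B0 : 0 < B.
  apply: ltr_pwDl; last by rewrite mulr_ge0 ?sqr_ge0.
  by rewrite mulr_gt0 // invr_gt0 exprn_gt0.
have gap : x u 0 ^+ k * B <= Delta%:R - rho.
  rewrite (degree_gapE _ k0 xE x1) /B mulrDr; apply: lerD.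
    have -> : x u 0 ^+ k * ((n%:R * Delta%:R - K) * gamma ^- k) =
        (n%:R * Delta%:R - K) * x v 0 ^+ k.
      by rewrite gE expr_div_n; field; rewrite !expf_neq0 // gt_eqF.
    rewrite KE mulr_suml; apply: ler_sum => i _; apply: ler_wpM2l => //.
    by rewrite lerXn2r // nnegrE ltW.
  have := spread_le_edge_defects u v hk hconn (fun i => ltW (xpos i)).
  rewrite -hD; apply: le_trans; rewrite -/c mulrCA; apply: ler_wpM2l => //.
  rewrite powRN powR_half ?(ltW gp) // gE sqrtrM ?(ltW up) // sqrtrV ?(ltW vp) //.
  have su : 0 < Num.sqrt (x u 0) by rewrite sqrtr_gt0.
  have sv : 0 < Num.sqrt (x v 0) by rewrite sqrtr_gt0.
  (* Both sides are squares, since [x u ^+ k = (sqrt (x u) ^+ k) ^+ 2]. *)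
  rewrite -{1}[x u 0]sqr_sqrtr ?(ltW up) // -exprM mulnC exprM -exprMn expr_div_n.
  rewrite le_eqVlt; apply/predU1P; left; congr (_ ^+ 2).
  by field; rewrite !expf_neq0 // gt_eqF.
have radius : rho < K * x u 0 ^+ k.
  rewrite /K hm; apply: (radius_lt_edges k0 hirr _ xE x1) => i.
  by rewrite xpos umax.
rewrite -addrA -/B ltr_pdivlMr; last exact: addr_gt0.
have := ltr_pM2r B0 rho (K * x u 0 ^+ k); rewrite radius => h1.
have := ler_pM2l K0 (x u 0 ^+ k * B) (Delta%:R - rho); rewrite gap => h2.
rewrite mulrDr; lra.
Qed.
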